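(* Let $R$ be a complete discrete valuation ring of characteristic $2$ with maximal ideal $\mathfrak{p}$ and finite residue field $k=R/\mathfrak{p}$ with $|k|>9$. Let $H$ be a closed subgroup of $\mathrm{GL}_2(R)$ whose image in $\mathrm{GL}_2(k)$ contains $\mathrm{SL}_2(k)$. Let $H'\subset H$ be the intersection of all closed subgroups of index $2$ in $H$, and assume that $\mathrm{Tr}\,\mathrm{Ad}(H')$ topologically generates the subring $R^2=\{x^2\mid x\in R\}$. Then $H^{\mathrm{der}}=\mathrm{SL}_2(R)$.
   Context: $\mathrm{Ad}$ is the adjoint representation of $\mathrm{GL}_2$ on $\mathfrak{gl}_2$, $X\mapsto hXh^{-1}$, and $\mathrm{Tr}\,\mathrm{Ad}(H')=\{\mathrm{Tr}\,\mathrm{Ad}(h)\mid h\in H'\}$. ''Topologically generates'' means the smallest closed subring containing the set is the given ring. $H^{\mathrm{der}}$ is the closure of the derived group of $H$. *)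

(* Defs.v *)
From HB Require Import structures.
From mathcomp Require Import all_boot all_order all_algebra all_field.
Set Implicit Arguments.
Unset Strict Implicit.
Unset Printing Implicit Defensive.
Import GRing.Theory.
Local Open Scope ring_scope.

Section Defs.
Variable R : idomainType.
(* pi : a uniformizer; the maximal ideal p is pi R *)
Variable pi : R.

Definition pi_dvd (m : nat) (x : R) : Prop := exists y : R, x = pi ^+ m * y.

Definition is_dvr : Prop :=
  pi != 0 /\ pi \notin GRing.unit /\
  forall x : R, x != 0 -> exists (n : nat) (u : R), u \is a GRing.unit /\ x = u * pi ^+ n.

Definition cvg (u : nat -> R) (l : R) : Prop :=
  forall m : nat, exists N : nat, forall n, (N <= n)%N -> pi_dvd m (u n - l).
Definition cauchy (u : nat -> R) : Prop :=
  forall m : nat, exists N : nat, forall i j, (N <= i)%N -> (N <= j)%N -> pi_dvd m (u i - u j).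
Definition complete : Prop := forall u, cauchy u -> exists l, cvg u l.

Definition closed_R (S : R -> Prop) : Prop :=
  forall u l, (forall n, S (u n)) -> cvg u l -> S l.
Definition subring (S : R -> Prop) : Prop :=
  S 1 /\ (forall x y, S x -> S y -> S (x - y)) /\ (forall x y, S x -> S y -> S (x * y)).
Definition top_generates (S T : R -> Prop) : Prop :=
  forall x, (forall U, closed_R U -> subring U -> (forall y, S y -> U y) -> U x) <-> T x.

Definition mx_cvg (A : nat -> 'M[R]_2) (L : 'M[R]_2) : Prop :=
  forall i j, cvg (fun n => A n i j) (L i j).
Definition closed_mx (S : 'M[R]_2 -> Prop) : Prop :=
  forall A L, (forall n, S (A n)) -> mx_cvg A L -> S L.
Definition closure_mx (S : 'M[R]_2 -> Prop) (L : 'M[R]_2) : Prop :=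
  exists A, (forall n, S (A n)) /\ mx_cvg A L.

Definition subgroup_GL2 (H : 'M[R]_2 -> Prop) : Prop :=
  (forall A, H A -> A \in unitmx) /\ H 1%:M /\
  (forall A B, H A -> H B -> H (A *m B)) /\ (forall A, H A -> H (invmx A)).

Definition index_two (H K : 'M[R]_2 -> Prop) : Prop :=
  subgroup_GL2 K /\ (forall A, K A -> H A) /\
  exists g, H g /\ ~ K g /\ forall A, H A -> K A \/ K (invmx g *m A).

Definition Hprime (H : 'M[R]_2 -> Prop) (A : 'M[R]_2) : Prop :=
  H A /\ forall K, closed_mx K -> index_two H K -> K A.

Definition TrAd (h : 'M[R]_2) : R :=
  \tr (lin_mx (fun X : 'M[R]_2 => h *m X *m invmx h)).

Definition mxcommutator (A B : 'M[R]_2) : 'M[R]_2 :=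
  A *m B *m invmx A *m invmx B.

Definition derived (H : 'M[R]_2 -> Prop) (A : 'M[R]_2) : Prop :=
  forall K, subgroup_GL2 K -> (forall g h, H g -> H h -> K (mxcommutator g h)) -> K A.

Definition Hder (H : 'M[R]_2 -> Prop) : 'M[R]_2 -> Prop := closure_mx (derived H).

End Defs.

(* Main.v *)
(** Let D be the derived group and consider the graded pieces of its congruence filtration, which
   are SL_2(k)-stable additive subgroups of sl_2(k).  In characteristic 2 such a subgroup is either
   contained in the scalars or equal to sl_2(k), so at every level N it suffices to find one
   non-scalar element.

   For N >= 2 commutators of congruence subgroups only yield scalars, since [sl_2, sl_2] is the
   center.  Instead one lifts the scalar 1 + pi^m, where 2m is N or N - 1: its determinant is
   1 + pi^(2m), so the lift equals (1 + pi^m) + pi^(2m) C with tr C = 1 mod pi, and its commutator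
   with a suitable unipotent element is non-scalar at level N.

   At N = 1 the trace hypothesis enters.  If level 1 were scalar, the image of H in PGL_2(R/pi^2)
   would be a lift of SL_2(k), described by a cocycle with values in gl_2(k)/k.  This cocycle is a
   coboundary, so after conjugation every h in H is c (G + pi^2 N) with c in R and the entries of
   G fourth powers.  Then det h / c^2 modulo fourth powers and pi^3 is a character of H to (k, +),
   which is trivial on H'; hence Tr Ad(H') lies in the closed subring R^4 + pi^3 R, which does not
   contain pi^2. *)

Require Import Defs.
From HB Require Import structures.
From mathcomp Require Import all_boot all_order all_algebra all_field.
From mathcomp Require Import ring.
From Stdlib Require Import ClassicalEpsilon.
Import GRing.Theory.
Local Open Scope ring_scope.

Lemma exists_choice_function (S T : Type) (Q : S -> T -> Prop) :
  (forall x, exists y, Q x y) -> exists f, forall x, Q x (f x).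
Proof.
move=> hQ; exists (fun x => proj1_sig (constructive_indefinite_description _ (hQ x))) => x.
by case: constructive_indefinite_description.
Qed.

(** * Two by two matrices *)

Section TwoByTwo.
Context {A : comNzRingType}.
Implicit Types (a b c d : A) (X Y : 'M[A]_2).

Definition mx2 a b c d : 'M[A]_2 :=
  \matrix_(i, j) if i == 0 then (if j == 0 then a else b)
                 else (if j == 0 then c else d).

Lemma mx2_eta X : X = mx2 (X 0 0) (X 0 1) (X 1 0) (X 1 1).
Proof.
apply/matrixP => i j; rewrite mxE.
by case: i => [[|[|//]] ?]; case: j => [[|[|//]] ?] /=; congr (X _ _); apply: val_inj.
Qed.

Lemma mx2_ex X : exists a b c d, X = mx2 a b c d.
Proof. by exists (X 0 0), (X 0 1), (X 1 0), (X 1 1); apply: mx2_eta. Qed.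

Lemma mx2_00 a b c d : mx2 a b c d 0 0 = a. Proof. by rewrite mxE. Qed.
Lemma mx2_01 a b c d : mx2 a b c d 0 1 = b. Proof. by rewrite mxE. Qed.
Lemma mx2_10 a b c d : mx2 a b c d 1 0 = c. Proof. by rewrite mxE. Qed.
Lemma mx2_11 a b c d : mx2 a b c d 1 1 = d. Proof. by rewrite mxE. Qed.

Lemma mx2_add a b c d a' b' c' d' :
  mx2 a b c d + mx2 a' b' c' d' = mx2 (a + a') (b + b') (c + c') (d + d').
Proof. by rewrite [LHS]mx2_eta !mxE. Qed.

Lemma mx2_opp a b c d : - mx2 a b c d = mx2 (- a) (- b) (- c) (- d).
Proof. by rewrite [LHS]mx2_eta !mxE. Qed.

Lemma mx2_scale x a b c d : x *: mx2 a b c d = mx2 (x * a) (x * b) (x * c) (x * d).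
Proof. by rewrite [LHS]mx2_eta !mxE. Qed.

Lemma mx2_scalar x : x%:M = mx2 x 0 0 x.
Proof. by rewrite [LHS]mx2_eta !mxE. Qed.

Lemma mx2_one : (1 : 'M[A]_2) = mx2 1 0 0 1.
Proof. exact: mx2_scalar. Qed.

Lemma mx2_mul a b c d a' b' c' d' :
  mx2 a b c d * mx2 a' b' c' d' =
  mx2 (a * a' + b * c') (a * b' + b * d') (c * a' + d * c') (c * b' + d * d').
Proof.
rewrite -mulmxE [LHS]mx2_eta !mxE !big_ord_recl !big_ord0 !mxE /=.
by rewrite !addr0.
Qed.

Lemma mx2_tr a b c d : \tr (mx2 a b c d) = a + d.
Proof. by rewrite /mxtrace !big_ord_recl big_ord0 !mxE /= addr0. Qed.

Lemma mx2_det a b c d : \det (mx2 a b c d) = a * d - b * c.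
Proof.
rewrite (expand_det_row _ 0) !big_ord_recl big_ord0 /cofactor !det_mx11 !mxE /=.
by rewrite addr0 expr0 expr1 mul1r mulN1r mulrN.
Qed.

Lemma mx2_adj a b c d : \adj (mx2 a b c d) = mx2 d (- b) (- c) a.
Proof.
rewrite [LHS]mx2_eta !mxE /cofactor !det_mx11 !mxE /=.
by rewrite ?(expr0, expr1, mul1r, mulN1r) /= -signr_odd /= expr0 mul1r.
Qed.

Definition mx2E := (mx2_one, mx2_scalar, mx2_add, mx2_opp, mx2_scale, mx2_mul,
  mx2_adj, mx2_tr, mx2_det, mx2_00, mx2_01, mx2_10, mx2_11).

Lemma mx2_congr a b c d a' b' c' d' :
  a = a' -> b = b' -> c = c' -> d = d' -> mx2 a b c d = mx2 a' b' c' d'.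
Proof. by move=> -> -> -> ->. Qed.

Lemma mx2_inj a b c d a' b' c' d' :
  mx2 a b c d = mx2 a' b' c' d' -> [/\ a = a', b = b', c = c' & d = d'].
Proof.
by move=> e; split; [move: (congr1 (fun X : 'M_2 => X 0 0) e)
  | move: (congr1 (fun X : 'M_2 => X 0 1) e)
  | move: (congr1 (fun X : 'M_2 => X 1 0) e)
  | move: (congr1 (fun X : 'M_2 => X 1 1) e)]; rewrite !mx2E.
Qed.

Definition upper1 x := mx2 1 x 0 1.
Definition lower1 x := mx2 1 0 x 1.

Lemma det_upper1 x : \det (upper1 x) = 1. Proof. by rewrite !mx2E; ring. Qed.
Lemma det_lower1 x : \det (lower1 x) = 1. Proof. by rewrite !mx2E; ring. Qed.

Lemma det_mulr X Y : \det (X * Y) = \det X * \det Y.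
Proof. by rewrite -mulmxE det_mulmx. Qed.

Lemma mul_adjr X : X * \adj X = (\det X)%:M. Proof. exact: mul_mx_adj. Qed.
Lemma mul_adjl X : \adj X * X = (\det X)%:M. Proof. exact: mul_adj_mx. Qed.

End TwoByTwo.

Lemma map_mx2 (A B : comNzRingType) (f : A -> B) a b c d :
  map_mx f (mx2 a b c d) = mx2 (f a) (f b) (f c) (f d).
Proof. by rewrite [LHS]mx2_eta !mxE. Qed.

(** * Arithmetic in characteristic 2 *)

Section Char2.
Variables (A : comNzRingType) (A2 : 2%N \in [pchar A]).

(** An identity that holds only modulo 2 becomes one valid in every characteristic once the multiple
    [c * 2] by which its sides differ is named; [ring] or [field] then settles it. *)
Lemma eq_mod2 (c x y : A) : x = y + c * 2 -> x = y.
Proof. by move->; rewrite (pcharf0 A2) mulr0 addr0. Qed.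

Lemma oppr2 (x : A) : - x = x.
Proof. by apply: (eq_mod2 (- x)); ring. Qed.

Lemma addrr2 (x : A) : x + x = 0.
Proof. by apply: (eq_mod2 x); ring. Qed.

Lemma addr2_eq (x y : A) : x + y = 0 -> x = y.
Proof. by move=> e; rewrite -[x]addr0 -(addrr2 y) addrA e add0r. Qed.

Lemma addrrM2 (X : 'M[A]_2) : X + X = 0.
Proof. by apply/matrixP => i j; rewrite !mxE addrr2. Qed.

Definition frob2 : A -> A := pFrobenius_aut A2 \o pFrobenius_aut A2.
HB.instance Definition _ := GRing.RMorphism.on frob2.

Lemma frob2E x : frob2 x = x ^+ 4.
Proof. by rewrite /frob2 /= !pFrobenius_autE -exprM. Qed.

Lemma expr4D (x y : A) : (x + y) ^+ 4 = x ^+ 4 + y ^+ 4.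
Proof. by rewrite -!frob2E rmorphD. Qed.

End Char2.

(** If the lower left entry is nonzero, the matrix is a product of an upper, a lower and an upper
    unipotent. If it is 0, then [a != 0], and adding the first row to the second puts [a] in that
    corner. *)
Lemma SL2_ind (k : fieldType) (P : 'M[k]_2 -> Prop) :
  (forall x, P (upper1 x)) -> (forall x, P (lower1 x)) ->
  (forall X Y, \det X = 1 -> \det Y = 1 -> P X -> P Y -> P (X * Y)) ->
  forall X, \det X = 1 -> P X.
Proof.
move=> PU PL PM.
have step a b c d : \det (mx2 a b c d) = 1 -> c != 0 -> P (mx2 a b c d).
  rewrite mx2_det => e c0.
  suff -> : mx2 a b c d = upper1 ((a - 1) / c) * lower1 c * upper1 ((d - 1) / c).
    by apply: (PM); [|exact: det_upper1|apply: (PM); rewrite ?det_upper1 ?det_lower1|];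
      rewrite ?det_mulr ?det_upper1 ?det_lower1 ?mulr1.
  rewrite !mx2E; apply: mx2_congr; try by field.
  have -> : b = (a * d - 1) / c by rewrite -e; field.
  by field.
move=> X; have [a [b [c [d ->]]]] := mx2_ex X => e.
have [c0|c0] := eqVneq c 0; last exact: step.
have a0 : a != 0.
  apply/eqP=> a0; move: e; rewrite mx2_det c0 a0 mul0r mulr0 subr0.
  by move/eqP; rewrite eq_sym oner_eq0.
have -> : mx2 a b c d = lower1 (- 1) * mx2 a b a (b + d).
  by rewrite !mx2E c0; apply: mx2_congr; ring.
have e' : \det (mx2 a b a (b + d)) = 1.
  by move: e; rewrite !mx2_det c0 => <-; ring.
by apply: (PM); rewrite ?det_lower1 //; apply: step.
Qed.

Lemma addmxE (A : nzRingType) (X Y : 'M[A]_2) i j : (X + Y) i j = X i j + Y i j.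
Proof. exact: mxE. Qed.

(** * Finite fields of characteristic 2 and stable subgroups of [sl_2(k)] *)

Section FiniteChar2.
Variables (k : finFieldType) (k2 : 2%N \in [pchar k]) (kbig : (9 < #|k|)%N).
Implicit Types (x y z a : k) (X Y g : 'M[k]_2).

Lemma exists_notin (s : seq k) : (size s <= 9)%N -> exists x, x \notin s.
Proof.
move=> hs; have [/existsP //|/existsPn h] := boolP [exists x, x \notin s].
have : (#|k| <= size s)%N.
  apply: leq_trans (card_size s); apply: subset_leq_card.
  by apply/subsetP => x _; move: (h x); rewrite negbK.
by move=> /leq_trans/(_ hs); rewrite leqNgt kbig.
Qed.

Lemma sqr_inj2 x y : x ^+ 2 = y ^+ 2 -> x = y.
Proof.
move=> e; apply: (addr2_eq _ k2); apply/eqP.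
have : (x + y) ^+ 2 == 0.
  by apply/eqP/(@eq_mod2 _ k2 (x * y + y ^+ 2)); rewrite sqrrD e; ring.
by rewrite expf_eq0.
Qed.

Lemma sqrt_ex x : exists y, x = y ^+ 2.
Proof.
have [f _ fK] := injF_bij sqr_inj2.
by exists (f x); rewrite fK.
Qed.

Lemma root4_ex x : exists y, x = y ^+ 4.
Proof.
have [y ->] := sqrt_ex x; have [z ->] := sqrt_ex y.
by exists z; rewrite -exprM.
Qed.

Lemma sqr_neq1 a : a != 1 -> a ^+ 2 + 1 != 0.
Proof.
move=> a1; apply: contra_neq a1 => e; apply: sqr_inj2.
by rewrite expr1n; apply: (addr2_eq _ k2).
Qed.

(** Unipotent conjugation produces an upper triangular element, the torus rescales its corner
    independently of its diagonal, and sums then separate the scalars from the nilpotent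
    directions. *)
Lemma conj_stable_traceless (S : 'M[k]_2 -> Prop) :
  (forall X Y, S X -> S Y -> S (X + Y)) ->
  (forall g X, \det g = 1 -> S X -> S (g * X * \adj g)) ->
  (forall X, S X -> \tr X = 0) ->
  (exists2 X, S X & ~ (exists z, X = z%:M)) ->
  forall X, \tr X = 0 -> S X.
Proof.
move=> SD SJ S0 [B SB Bns].
have detw : \det (mx2 0 1 1 0 : 'M[k]_2) = 1.
  by rewrite mx2_det mul0r mul1r sub0r (oppr2 _ k2).
have [p [b [c [c0 SB']]]] : exists p b c, c != 0 /\ S (mx2 p b c p).
  have [p [b [c [r eB]]]] := mx2_ex B; rewrite {}eB in SB Bns.
  have := S0 _ SB; rewrite mx2_tr => /(addr2_eq _ k2) er; rewrite -{}er in SB Bns.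
  have [c0|c0] := eqVneq c 0; last by exists p, b, c.
  have [b0|b0] := eqVneq b 0.
    by case: Bns; exists p; rewrite c0 b0 mx2_scalar.
  exists p, c, b; split=> //.
  have := SJ _ _ detw SB; congr S.
  by rewrite !mx2E !(oppr2 _ k2); apply: mx2_congr; ring.
(* For [U = upper1 x], the sum of [SB'] and its conjugate by [U] loses [p] and [b]. Conjugation by
   the diagonal matrix with entries [y / x] and [x / y] then turns the corner [x ^+ 2 * c] into
   [y ^+ 2 * c]. *)
have S1 x y : x != 0 -> y != 0 -> S (mx2 (x * c) (y ^+ 2 * c) 0 (x * c)).
  move=> x0 y0.
  have SUx : S (mx2 (x * c) (x ^+ 2 * c) 0 (x * c)).
    have := SD _ _ (SJ _ _ (det_upper1 x) SB') SB'; congr S.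
    rewrite !mx2E !(oppr2 _ k2); apply: mx2_congr.
    - by apply: (@eq_mod2 _ k2 p); ring.
    - by apply: (@eq_mod2 _ k2 (b + x * p)); ring.
    - by apply: (@eq_mod2 _ k2 c); ring.
    - by apply: (@eq_mod2 _ k2 p); ring.
  have ds : \det (mx2 (y / x) 0 0 (x / y)) = 1 by rewrite mx2_det; field; rewrite ?x0 ?y0.
  have := SJ _ _ ds SUx; congr S.
  by rewrite !mx2E; apply: mx2_congr; field; rewrite ?x0 ?y0.
have Sz z : S (z%:M).
  have [z0|z0] := eqVneq z 0.
    have := SD _ _ SB' SB'; congr S.
    by rewrite z0 !mx2E !(addrr2 _ k2).
  (* The elements with diagonals [x * c] and [(x + z / c) * c] and equal corners add up to the
     scalar [z]; both parameters have to be nonzero. *)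
  have [x] := @exists_notin [:: 0; z / c] isT.
  rewrite !inE negb_or => /andP[x0 xz].
  have xz0 : x + z / c != 0.
    by apply: contra xz => /eqP/(addr2_eq _ k2)/eqP.
  have := SD _ _ (S1 _ 1 x0 (oner_neq0 _)) (S1 _ 1 xz0 (oner_neq0 _)); congr S.
  rewrite !mx2E; apply: mx2_congr.
  - by apply: (@eq_mod2 _ k2 (x * c)); field.
  - by apply: (@eq_mod2 _ k2 c); ring.
  - by ring.
  - by apply: (@eq_mod2 _ k2 (x * c)); field.
have SU y : S (mx2 0 y 0 0).
  have [y0|y0] := eqVneq y 0.
    by have := Sz 0; congr S; rewrite y0 mx2E.
  have [t et] := sqrt_ex (y / c).
  have t0 : t != 0.
    apply: contra_eq_neq et => ->.
    by rewrite expr0n /= mulf_neq0 ?invr_eq0.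
  have := SD _ _ (S1 1 _ (oner_neq0 _) t0) (Sz c); congr S.
  rewrite !mx2E -et; apply: mx2_congr.
  - by apply: (@eq_mod2 _ k2 c); ring.
  - by field.
  - by ring.
  - by apply: (@eq_mod2 _ k2 c); ring.
have SL y : S (mx2 0 0 y 0).
  have := SJ _ _ detw (SU y); congr S.
  by rewrite !mx2E !(oppr2 _ k2); apply: mx2_congr; ring.
move=> X; have [x [y [z [r ->]]]] := mx2_ex X.
rewrite mx2_tr => /(addr2_eq _ k2) <-.
have := SD _ _ (SD _ _ (Sz x) (SU y)) (SL z); congr S.
by rewrite !mx2E; apply: mx2_congr; ring.
Qed.

(** These are the three coordinates of a cocycle on a unipotent subgroup, with torus weights 2, -2
    and 0. Every element is a square, so the weights determine all values at nonzero points from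
    those at 1. Additivity at [1 + z] gives [r 1 = 0], and then the quadratic term in the law for
    [p] gives [q 1 = 0]. *)
Lemma unipotent_cocycle (p q r : k -> k) :
  (forall a x, a != 0 -> [/\ p (a ^+ 2 * x) = a ^+ 2 * p x,
     a ^+ 2 * q (a ^+ 2 * x) = q x & r (a ^+ 2 * x) = r x]) ->
  (forall x y, [/\ p (x + y) = p x + (p y + x * r y + x ^+ 2 * q y),
     q (x + y) = q x + q y & r (x + y) = r x + r y]) ->
  forall x, [/\ p x = x * p 1, q x = 0 & r x = 0].
Proof.
move=> hs hd.
have [p0 q0 r0] : [/\ p 0 = 0, q 0 = 0 & r 0 = 0].
  have [] := hd 0 0; rewrite addr0 => e1 e2 e3; split.
  - rewrite e1; apply: (@eq_mod2 _ k2 (p 0)); ring.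
  - rewrite e2; apply: (@eq_mod2 _ k2 (q 0)); ring.
  - rewrite e3; apply: (@eq_mod2 _ k2 (r 0)); ring.
have h1 y : y != 0 -> [/\ p y = y * p 1, y * q y = q 1 & r y = r 1].
  have [a ->] := sqrt_ex y; rewrite expf_eq0 /= => /(hs _ 1).
  by rewrite mulr1.
have [z] := @exists_notin [:: 0; 1] isT.
rewrite !inE negb_or => /andP[z0 z1].
have z10 : 1 + z != 0 by apply: contra z1 => /eqP/(addr2_eq _ k2)/eqP; rewrite eq_sym.
have [ez1 ez2 ez3] := h1 _ z0; have [ey1 ey2 ey3] := h1 _ z10.
have [e1 e2 e3] := hd 1 z.
have r1 : r 1 = 0.
  by rewrite -ey3 e3 ez3; apply: (addrr2 _ k2).
have q1 : q 1 = 0.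
  apply/eqP; rewrite -ez2 mulf_eq0 (negPf z0) /=; apply/eqP.
  apply: (@addrI _ (p (1 + z))); rewrite addr0 {2}e1 ez3 r1 ey1 ez1; ring.
move=> x; have [->|x0] := eqVneq x 0; first by rewrite mul0r.
have [-> e ->] := h1 _ x0; split=> //.
by apply/eqP; move/eqP: e; rewrite q1 mulf_eq0 (negPf x0).
Qed.

(** Coordinates on [gl_2(k)] modulo scalars: in characteristic 2 the trace is the difference of the
    diagonal entries. *)
Definition pgl_coord X := (X 0 1, X 1 0, X 0 0 + X 1 1).

Lemma pgl_coordP X Y : pgl_coord X = pgl_coord Y <-> exists z, X = Y + z%:M.
Proof.
have [a [b [c [d ->]]]] := mx2_ex X; have [a' [b' [c' [d' ->]]]] := mx2_ex Y.
rewrite /pgl_coord !mx2E; split=> [[-> -> e]|[z]].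
  exists (a - a'); rewrite !mx2E; apply: mx2_congr; try ring.
  rewrite -[d](addKr a) e; apply: (@eq_mod2 _ k2 (a' - a)); ring.
rewrite !mx2E => /mx2_inj[-> -> -> ->]; congr (_, _, _); try ring.
apply: (@eq_mod2 _ k2 z); ring.
Qed.

Definition diag2 a := mx2 a 0 0 a^-1.

Lemma det_diag2 a : a != 0 -> \det (diag2 a) = 1.
Proof. by move=> a0; rewrite mx2_det; field. Qed.

Definition cocycle (D : 'M[k]_2 -> 'M[k]_2) :=
  forall g h, \det g = 1 -> \det h = 1 -> pgl_coord (D (g * h)) =
    pgl_coord (D g + g * D h * \adj g).

(** The added term is the coboundary of [X]; in the cocycle identity [g * X * \adj g] occurs twice
    and cancels. *)
Lemma cocycle_sub D X : cocycle D -> cocycle (fun g => D g + (X + g * X * \adj g)).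
Proof.
move=> hD g h g1 h1; have /pgl_coordP[z ez] := hD g h g1 h1.
apply/pgl_coordP; exists z; rewrite {}ez.
have -> : \adj (g * h) = \adj h * \adj g.
  have [a [b [c [d ->]]]] := mx2_ex g; have [a' [b' [c' [d' ->]]]] := mx2_ex h.
  by rewrite !mx2E; apply: mx2_congr; ring.
rewrite !mulrDr !mulrDl !mulrA.
move: (g * h * X * _ * _) (g * X * _) (g * D h * _) (D g) => A B C E.
apply/matrixP => i j; rewrite ![in LHS]mxE ![in RHS]mxE.
apply: (@eq_mod2 _ k2 (- B i j)); ring.
Qed.

(** * Cocycles of SL_2(k) with values in gl_2(k)/k *)

Section CocycleOfGenerators.
Variables (D : 'M[k]_2 -> 'M[k]_2) (hD : cocycle D).
Let b g := D g 0 1.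
Let c g := D g 1 0.
Let e g := D g 0 0 + D g 1 1.

Lemma cocycle_upper1 x h : \det h = 1 ->
  [/\ b (upper1 x * h) = b (upper1 x) + (b h + x * e h + x ^+ 2 * c h),
      c (upper1 x * h) = c (upper1 x) + c h & e (upper1 x * h) = e (upper1 x) + e h].
Proof.
move=> h1; have := hD _ _ (det_upper1 x) h1; rewrite /pgl_coord /b /c /e.
have [p [q [r [s ->]]]] := mx2_ex (D h).
rewrite !addmxE !mx2E => [[-> -> ->]]; split; try ring.
by apply: (@eq_mod2 _ k2 (- x * p - x ^+ 2 * r)); ring.
Qed.

Lemma cocycle_lower1 x h : \det h = 1 ->
  [/\ b (lower1 x * h) = b (lower1 x) + b h,
      c (lower1 x * h) = c (lower1 x) + (c h + x * e h + x ^+ 2 * b h) &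
      e (lower1 x * h) = e (lower1 x) + e h].
Proof.
move=> h1; have := hD _ _ (det_lower1 x) h1; rewrite /pgl_coord /b /c /e.
have [p [q [r [s ->]]]] := mx2_ex (D h).
rewrite !addmxE !mx2E => [[-> -> ->]]; split; try ring.
by apply: (@eq_mod2 _ k2 (- x * s - x ^+ 2 * q)); ring.
Qed.

Lemma cocycle_diag2 a h : a != 0 -> \det h = 1 ->
  [/\ b (diag2 a * h) = b (diag2 a) + a ^+ 2 * b h,
      c (diag2 a * h) = c (diag2 a) + a ^- 2 * c h & e (diag2 a * h) = e (diag2 a) + e h].
Proof.
move=> a0 h1; have := hD _ _ (det_diag2 _ a0) h1; rewrite /pgl_coord /b /c /e.
have [p [q [r [s ->]]]] := mx2_ex (D h).
by rewrite !addmxE !mx2E => [[-> -> ->]]; split; field.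
Qed.

(** The torus is commutative: expanding the cocycle on [diag2 a * diag2 y] in both orders multiplies
    the off-diagonal values at [y] by [a ^+ 2 + 1] or [a ^- 2 + 1], both nonzero, and the result is
    0. *)
Lemma cocycle_torus a : a != 0 -> a != 1 -> b (diag2 a) = 0 -> c (diag2 a) = 0 ->
  forall y, y != 0 -> [/\ b (diag2 y) = 0, c (diag2 y) = 0 & e (diag2 y) = 0].
Proof.
move=> a0 a1 ba ca y y0.
have [eb ec _] := cocycle_diag2 a (diag2 y) a0 (det_diag2 y y0).
have [eb' ec' _] := cocycle_diag2 y (diag2 a) y0 (det_diag2 a a0).
have comm : diag2 a * diag2 y = diag2 y * diag2 a by rewrite !mx2E; apply: mx2_congr; ring.
have by0 : b (diag2 y) = 0.
  apply/eqP; move: eb'; rewrite -comm eb ba mulr0 addr0 add0r => /eqP.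
  rewrite -subr_eq0 -{2}[b _]mul1r -mulrBl mulf_eq0 (oppr2 _ k2) (negPf (sqr_neq1 _ a1)).
  by [].
have cy0 : c (diag2 y) = 0.
  apply/eqP; move: ec'; rewrite -comm ec ca mulr0 addr0 add0r => /eqP.
  rewrite -subr_eq0 -{2}[c _]mul1r -mulrBl mulf_eq0 -exprVn (oppr2 _ k2).
  by rewrite (negPf (sqr_neq1 _ _)) // invr_eq1.
split=> //.
(* On the torus [e] is additive, and [diag2 y] is a square there, so [e] doubles to 0. *)
have [z ez] := sqrt_ex y; have z0 : z != 0 by move: y0; rewrite ez expf_eq0.
have -> : diag2 y = diag2 z * diag2 z by rewrite !mx2E ez; apply: mx2_congr; field.
by have [_ _ ->] := cocycle_diag2 z (diag2 z) z0 (det_diag2 z z0); apply: (addrr2 _ k2).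
Qed.

(** Vanishing on the torus makes the cocycle equivariant on both unipotent subgroups, where
    [unipotent_cocycle] leaves only [c (lower1 1)] undetermined; a Weyl element eliminates it. *)
Lemma cocycle_trivial a : a != 0 -> a != 1 -> b (diag2 a) = 0 -> c (diag2 a) = 0 ->
  b (upper1 1) = 0 -> forall g, \det g = 1 -> pgl_coord (D g) = 0.
Proof.
move=> a0 a1 ba ca bU.
have T y : y != 0 -> [/\ b (diag2 y) = 0, c (diag2 y) = 0 & e (diag2 y) = 0] :=
  cocycle_torus _ a0 a1 ba ca y.
have hU x : [/\ b (upper1 x) = x * b (upper1 1), c (upper1 x) = 0 & e (upper1 x) = 0].
  apply: (unipotent_cocycle (b \o upper1) (c \o upper1) (e \o upper1)) => [y z y0|y z] /=.
    have [bT cT eT] := T _ y0.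
    have [] := cocycle_diag2 y (upper1 z) y0 (det_upper1 z).
    have -> : diag2 y * upper1 z = upper1 (y ^+ 2 * z) * diag2 y.
      by rewrite !mx2E; apply: mx2_congr; field.
    have [-> -> ->] := cocycle_upper1 (y ^+ 2 * z) _ (det_diag2 _ y0).
    rewrite bT cT eT !mulr0 !addr0 !add0r => -> -> ->; split=> //.
    by field.
  have -> : upper1 (y + z) = upper1 y * upper1 z by rewrite !mx2E; apply: mx2_congr; ring.
  by have [-> -> ->] := cocycle_upper1 y _ (det_upper1 z).
have hL x : [/\ c (lower1 x) = x * c (lower1 1), b (lower1 x) = 0 & e (lower1 x) = 0].
  apply: (unipotent_cocycle (c \o lower1) (b \o lower1) (e \o lower1)) => [y z y0|y z] /=.
    have yV0 : y^-1 != 0 by rewrite invr_eq0.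
    have [bT cT eT] := T _ yV0.
    have [] := cocycle_diag2 y^-1 (lower1 z) yV0 (det_lower1 z).
    have -> : diag2 y^-1 * lower1 z = lower1 (y ^+ 2 * z) * diag2 y^-1.
      by rewrite !mx2E; apply: mx2_congr; field; rewrite ?y0 ?oner_eq0.
    have [-> -> ->] := cocycle_lower1 (y ^+ 2 * z) _ (det_diag2 _ yV0).
    rewrite bT cT eT !mulr0 !addr0 !add0r => -> -> ->; split=> //; by field; rewrite ?y0 ?oner_eq0.
  have -> : lower1 (y + z) = lower1 y * lower1 z by rewrite !mx2E; apply: mx2_congr; ring.
  by have [-> -> ->] := cocycle_lower1 y _ (det_lower1 z).
have U0 x : [/\ b (upper1 x) = 0, c (upper1 x) = 0 & e (upper1 x) = 0].
  by have := hU x; rewrite bU mulr0.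
pose w : 'M[k]_2 := upper1 1 * (lower1 1 * upper1 1).
have dw : \det w = 1 by rewrite !det_mulr !det_upper1 det_lower1 !mul1r.
have cL : c (lower1 1) = 0.
  have [bw cw ew] : [/\ b w = c (lower1 1), c w = c (lower1 1) & e w = 0].
    have dLU : \det (lower1 1 * upper1 1 : 'M[k]_2) = 1
      by rewrite det_mulr det_upper1 det_lower1 mul1r.
    rewrite /w; have [-> -> ->] := cocycle_upper1 1 _ dLU.
    have [-> -> ->] := cocycle_lower1 1 _ (det_upper1 1).
    have [-> -> ->] := U0 1; have [_ -> ->] := hL 1.
    by split; ring.
  (* Expanding the cocycle on both sides gives [a ^+ 2 * b w = b w], and [b w] is [c (lower1 1)]. *)
  have comm : diag2 a * w = w * diag2 a^-1.
    rewrite /w !mx2E; apply: mx2_congr.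
    - by apply: (@eq_mod2 _ k2 (a - a^-1)); field; rewrite ?a0 ?oner_eq0.
    - by field; rewrite ?a0 ?oner_eq0.
    - by field; rewrite ?a0 ?oner_eq0.
    - by apply: (@eq_mod2 _ k2 (a^-1 - a)); field; rewrite ?a0 ?oner_eq0.
  have aV0 : a^-1 != 0 by rewrite invr_eq0.
  have [eb _ _] := cocycle_diag2 a w a0 dw; move: eb; rewrite comm.
  have dUa : \det (upper1 1 * diag2 a^-1) = 1 by rewrite det_mulr det_upper1 mul1r det_diag2.
  have dLUa : \det (lower1 1 * (upper1 1 * diag2 a^-1)) = 1 by rewrite det_mulr det_lower1 mul1r.
  rewrite /w -mulrA -mulrA.
  have [-> _ _] := cocycle_upper1 1 _ dLUa.
  have [-> -> ->] := cocycle_lower1 1 _ dUa.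
  have [-> -> ->] := cocycle_upper1 1 _ (det_diag2 _ aV0).
  have [-> -> ->] := T _ aV0; have [-> -> ->] := U0 1; have [_ -> ->] := hL 1.
  rewrite bw ba !(mulr0, addr0, add0r, expr1n, mul1r) => /eqP.
  rewrite -subr_eq0 -{1}[c _]mul1r -mulrBl mulf_eq0 (oppr2 _ k2) addrC.
  by rewrite (negPf (sqr_neq1 _ a1)) => /eqP.
apply: SL2_ind => [x|x|X Y X1 Y1].
- by have [b0 c0 e0] := U0 x; congr (_, _, _).
- by have [b0 c0 e0] := hL x; congr (_, _, _); rewrite // [LHS]b0 cL mulr0.
move=> DX DY; rewrite hD //.
have /pgl_coordP[z ->] : pgl_coord (D Y) = pgl_coord 0 by rewrite DY /pgl_coord !mxE addr0.
have -> : X * (0 + z%:M) * \adj X = z%:M.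
  by rewrite add0r -!mulmxE mul_mx_scalar -scalemxAl mul_mx_adj X1 scalemx1.
by rewrite -[RHS]DX; apply/pgl_coordP; exists z.
Qed.

End CocycleOfGenerators.

(* The vanishing of [H^1(SL_2(k), gl_2(k)/k)]. *)
Lemma cocycle_coboundary D : cocycle D ->
  exists X, forall g, \det g = 1 -> pgl_coord (D g) = pgl_coord (X + g * X * \adj g).
Proof.
move=> hD.
have [a] := @exists_notin [:: 0; 1] isT.
rewrite !inE negb_or => /andP[a0 a1].
have a2 := sqr_neq1 _ a1.
have a2V : a ^- 2 + 1 != 0 by rewrite -exprVn sqr_neq1 // invr_eq1.
(* The entries of [X] solve the three linear conditions of [cocycle_trivial]: the off-diagonal
   entries cancel [b] and [c] at [diag2 a], the diagonal difference cancels [b] at [upper1 1]. *)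
pose y := D (diag2 a) 1 0 / (a ^- 2 + 1).
pose X := mx2 (D (upper1 1) 0 1 + y) (D (diag2 a) 0 1 / (a ^+ 2 + 1)) y 0.
exists X => g g1.
have := cocycle_trivial _ (cocycle_sub _ X hD) a a0 a1 _ _ _ g g1.
have -> : (0 : k * k * k) = pgl_coord 0 by rewrite /pgl_coord !mxE addr0.
move=> /(_ _ _ _)/pgl_coordP h; apply/pgl_coordP; case: h.
- rewrite mxE /X !mx2E; apply: (@eq_mod2 _ k2 (D (diag2 a) 0 1)); by field.
- rewrite mxE /X !mx2E; apply: (@eq_mod2 _ k2 (D (diag2 a) 1 0)); rewrite /y; by field;
    rewrite a0 a2.
- rewrite !addmxE /X !mx2E.
  by apply: (@eq_mod2 _ k2 (D (diag2 a) 0 1 / (a ^+ 2 + 1) - y)); ring.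
move=> z; rewrite add0r => e; exists z.
by rewrite -e addrCA (addrrM2 _ k2) addr0.
Qed.

End FiniteChar2.

(** * Determinants, commutators and the trace of Ad *)

Lemma det_addZ (A : comNzRingType) (X C : 'M[A]_2) x :
  \det (X + x *: C) = \det X + x * (\tr (C * \adj X) + x * \det C).
Proof.
have [a [b [c [d ->]]]] := mx2_ex X; have [a' [b' [c' [d' ->]]]] := mx2_ex C.
by rewrite !mx2E; ring.
Qed.

Lemma det_1DZ (A : comNzRingType) (C : 'M[A]_2) x :
  \det (1 + x *: C) = 1 + x * (\tr C + x * \det C).
Proof. by rewrite det_addZ -[X in \adj X]/(1%:M) adj1 det1 mulr1. Qed.

Lemma eq_by_sub (A : zmodType) (x y a b : A) : x = y -> a - b = x - y -> a = b.
Proof. by move=> -> /eqP; rewrite subrr subr_eq0 => /eqP. Qed.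

Lemma mul_1DZ (A : comNzRingType) (X Y : 'M[A]_2) x :
  (1 + x *: X) * (1 + x *: Y) = 1 + x *: (X + Y + x *: (X * Y)).
Proof.
rewrite mulrDl mul1r mulrDr mulr1 -scalerAl -scalerAr !scalerDr -!addrA.
by congr (_ + _); rewrite addrCA.
Qed.

Lemma commutator_sub (A : unitRingType) (g h : A) :
  g \is a GRing.unit -> h \is a GRing.unit ->
  g * h * g^-1 * h^-1 = 1 + (g * h - h * g) * g^-1 * h^-1.
Proof.
by move=> gu hu; rewrite !mulrBl (mulrK gu) (divrr hu) addrCA subrr addr0.
Qed.

(** In the basis of elementary matrices the diagonal entry at [(i, j)] is [X i i * Y j j]. *)
Lemma tr_lin_mulmx (A : comNzRingType) n (X Y : 'M[A]_n) :
  \tr (lin_mx (fun Z : 'M[A]_n => X *m Z *m Y)) = \tr X * \tr Y.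
Proof.
rewrite /mxtrace (reindex _ (curry_mxvec_bij n n)) /= big_distrlr /= pair_big.
apply: eq_bigr => -[i j] _ /=.
rewrite mxE /= vec_mx_delta mxvecE.
rewrite !mxE (bigD1 j) //= big1 ?addr0 => [|l lj].
  rewrite mxE (bigD1 i) //= big1 ?addr0 => [|l li]; rewrite mxE ?eqxx ?mulr1 //.
  by rewrite (negPf li) mulr0.
rewrite mxE big1 ?mul0r // => m _.
by rewrite mxE (negPf lj) andbF mulr0.
Qed.

(** [Tr Ad h] is the product of the traces of [h] and its inverse, and in size two [\adj h] has the
    same trace as [h]. *)
Lemma TrAd_det (A : idomainType) (h : 'M[A]_2) :
  h \is a GRing.unit -> TrAd h * \det h = \tr h ^+ 2.
Proof.
rewrite -[_ \is a _]/(h \in unitmx) => hu; have hd := hu; rewrite unitmxE in hd.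
rewrite /TrAd tr_lin_mulmx /invmx hu mxtraceZ.
have -> : \tr (\adj h) = \tr h.
  by have [a [b [c [d ->]]]] := mx2_ex h; rewrite !mx2E addrC.
by rewrite mulrCA mulrC mulVKr.
Qed.

(** * Reduction modulo the uniformizer *)

Section ResidueField.
Context {R : idomainType} { pi : R} {k : finFieldType} {red : {rmorphism R -> k}}.
Hypothesis dvr : is_dvr pi.
Hypothesis R2 : 2%N \in [pchar R].
Hypothesis red_surj : forall y : k, exists x : R, red x = y.
Hypothesis red_ker : forall x : R, red x = 0 <-> pi_dvd pi 1 x.
Local Notation redm := (map_mx red).

Let pi0 : pi != 0. Proof. by case: dvr. Qed.

Lemma residue_pchar2 : 2%N \in [pchar k]. Proof. exact: (rmorph_pchar red). Qed.

Lemma red_pi : red pi = 0.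
Proof. by apply/red_ker; exists 1; rewrite mulr1. Qed.

Lemma red0_pi x : red x = 0 -> exists y, x = pi * y.
Proof. by move/red_ker. Qed.

Lemma expr_pi0 N : pi ^+ N != 0. Proof. by rewrite expf_neq0. Qed.

Lemma red_expi N : (0 < N)%N -> red (pi ^+ N) = 0.
Proof. by case: N => // N _; rewrite exprS rmorphM red_pi mul0r. Qed.

Lemma red_addZ x y N : (0 < N)%N -> red (x + pi ^+ N * y) = red x.
Proof. by move=> N0; rewrite rmorphD [X in _ + X]rmorphM red_expi // mul0r addr0. Qed.

Lemma red_unit x : red x != 0 -> x \is a GRing.unit.
Proof.
move=> rx; have x0 : x != 0 by apply: contraNneq rx => ->; rewrite rmorph0.
have [_ [_ /(_ x x0)[[|n] [u [uu ex]]]]] := dvr; first by rewrite ex expr0 mulr1.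
by move: rx; rewrite ex rmorphM (red_expi n.+1 isT) mulr0 eqxx.
Qed.

Lemma red_lift_mx (M : 'M[k]_2) : exists A, redm A = M.
Proof.
have [a [b [c [d ->]]]] := mx2_ex M.
have [[a' <-] [b' <-]] := (red_surj a, red_surj b).
have [[c' <-] [d' <-]] := (red_surj c, red_surj d).
by exists (mx2 a' b' c' d'); rewrite map_mx2.
Qed.

Lemma redm0_pi (A : 'M[R]_2) : redm A = 0 -> exists C, A = pi *: C.
Proof.
have [a [b [c [d ->]]]] := mx2_ex A; rewrite map_mx2.
have -> : (0 : 'M[k]_2) = mx2 0 0 0 0 by rewrite [LHS]mx2_eta !mxE.
move=> /mx2_inj[/red0_pi[a' ->] /red0_pi[b' ->] /red0_pi[c' ->] /red0_pi[d' ->]].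
by exists (mx2 a' b' c' d'); rewrite mx2E.
Qed.

Lemma redm_eq_pi (A B : 'M[R]_2) : redm A = redm B -> exists C, A = B + pi *: C.
Proof.
move=> e; have [|C eC] := redm0_pi (A - B); first by rewrite map_mxB e subrr.
by exists C; rewrite -eC addrC subrK.
Qed.

Lemma redmM (A B : 'M[R]_2) : redm (A * B) = redm A * redm B.
Proof. by rewrite -!mulmxE map_mxM. Qed.

Lemma redm_unit (A : 'M[R]_2) : \det (redm A) != 0 -> A \is a GRing.unit.
Proof. by rewrite det_map_mx => /red_unit; rewrite -unitmxE. Qed.

Lemma redm_inv (A : 'M[R]_2) : A \is a GRing.unit -> redm A^-1 = (redm A)^-1.
Proof. by move=> Au; rewrite (rmorphV (map_mx red : {rmorphism 'M[R]_2 -> 'M[k]_2})). Qed.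

Lemma redm_addZ (A C : 'M[R]_2) N : (0 < N)%N -> redm (A + pi ^+ N *: C) = redm A.
Proof. by move=> N0; rewrite map_mxD map_mxZ red_expi // scale0r addr0. Qed.

Lemma inv_det1 (F : comUnitRingType) (A : 'M[F]_2) : \det A = 1 -> A^-1 = \adj A.
Proof.
move=> A1; have Au : A \is a GRing.unit by rewrite -[_ \is a _]/(A \in unitmx) unitmxE A1 unitr1.
by apply: (mulrI Au); rewrite divrr // mul_adjr A1.
Qed.

Lemma det1_unit (F : comUnitRingType) (A : 'M[F]_2) : \det A = 1 -> A \is a GRing.unit.
Proof. by move=> A1; rewrite -[_ \is a _]/(A \in unitmx) unitmxE A1 unitr1. Qed.

(** * The derived group and its image over the residue field *)

Section DerivedGroup.
Variable H : 'M[R]_2 -> Prop.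
Hypothesis Hgrp : subgroup_GL2 H.
Local Notation D := (derived H).

Lemma subgroup_unit A : H A -> A \is a GRing.unit. Proof. by case: Hgrp => h _ /h. Qed.
Lemma subgroupM A B : H A -> H B -> H (A * B). Proof. by case: Hgrp => _ [_ [h _]]; exact: h. Qed.
Lemma subgroupV A : H A -> H A^-1. Proof. by case: Hgrp => _ [_ [_ h]]; exact: h. Qed.

Lemma derived_comm g h : H g -> H h -> D (g * h * g^-1 * h^-1).
Proof. by move=> Hg Hh K _; apply. Qed.

Lemma derived_sub A : D A -> H A.
Proof.
apply=> // g h Hg Hh.
by do !apply: subgroupM => //; apply: subgroupV.
Qed.

Lemma derived_unit A : D A -> A \is a GRing.unit.
Proof. by move/derived_sub/subgroup_unit. Qed.

Lemma derivedM A B : D A -> D B -> D (A * B).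
Proof.
move=> DA DB K Kg hK; have [_ [_ [h _]]] := Kg.
by apply: h; [exact: DA | exact: DB].
Qed.

Lemma derivedV A : D A -> D A^-1.
Proof.
move=> DA K Kg hK; have [_ [_ [_ h]]] := Kg.
by apply: h; exact: DA.
Qed.

Lemma derived_det A : D A -> \det A = 1.
Proof.
move=> DA; suff : \det A == 1 by move/eqP.
apply: (DA (fun A => \det A == 1)).
  split=> [B /eqP B1|]; first by rewrite unitmxE B1 unitr1.
  split; first by rewrite det1.
  split=> [B C /eqP B1 /eqP C1|B /eqP B1]; first by rewrite det_mulmx B1 C1 mulr1.
  by rewrite det_inv B1 invr1.
move=> g h /subgroup_unit gu /subgroup_unit hu.
move: gu hu; rewrite -[g \is a _]/(g \in unitmx) -[h \is a _]/(h \in unitmx) !unitmxE => gu hu.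
rewrite /mxcommutator !det_mulmx !det_inv.
by rewrite [_ * \det h]mulrC mulrK // divrr.
Qed.

Hypothesis kbig : (9 < #|k|)%N.
Hypothesis Hres : forall B : 'M[k]_2, \det B = 1 -> exists A, H A /\ redm A = B.

(** [SL_2(k)] is perfect: the commutator of [diag2 a] with [upper1 y] is
    [upper1 ((a ^+ 2 - 1) * y)], similarly for lower unipotents, and [a ^+ 2 + 1] is invertible. *)
Lemma derived_residual (g : 'M[k]_2) : \det g = 1 -> exists A, D A /\ redm A = g.
Proof.
have [a] := @exists_notin k kbig [:: 0; 1] isT.
rewrite !inE negb_or => /andP[a0 a1].
have a2 := sqr_neq1 k residue_pchar2 _ a1.
have comm x y : \det x = 1 -> \det y = 1 -> exists A, D A /\ redm A = x * y * \adj x * \adj y.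
  move=> x1 y1; have [[X [HX rX]] [Y [HY rY]]] := (Hres _ x1, Hres _ y1).
  exists (X * Y * X^-1 * Y^-1); split; first exact: derived_comm.
  by rewrite !redmM !redm_inv ?subgroup_unit // rX rY !inv_det1.
move: g; apply: SL2_ind => [x|x|X Y _ _ [A [DA <-]] [B [DB <-]]].
- have [A [DA rA]] := comm (diag2 k a) (upper1 (x / (a ^+ 2 + 1))) (det_diag2 k a a0)
    (det_upper1 _).
  exists A; split=> //; rewrite rA !mx2E; apply: mx2_congr; try by field;
    rewrite ?a0 ?a2 ?oner_eq0.
  by apply: (@eq_mod2 _ residue_pchar2 (- (x / (a ^+ 2 + 1)))); field; rewrite ?a0 ?a2.
- have [A [DA rA]] := comm (diag2 k a^-1) (lower1 (x / (a ^+ 2 + 1))) (det_diag2 k a^-1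
    (invr_neq0 a0)) (det_lower1 _).
  exists A; split=> //; rewrite rA !mx2E; apply: mx2_congr; try by field;
    rewrite ?a0 ?a2 ?oner_eq0.
  by rewrite !invrK; apply: (@eq_mod2 _ residue_pchar2 (- (x / (a ^+ 2 + 1)))); field;
    rewrite ?a0 ?a2.
- by exists (A * B); rewrite redmM; split=> //; apply: derivedM.
Qed.

(** * The congruence filtration *)

(* The [N]-th graded piece of the congruence filtration of the derived group. *)
Definition level N (X : 'M[k]_2) := exists C, D (1 + pi ^+ N *: C) /\ redm C = X.

(** Products in the derived group add residues, and conjugation by lifts from [derived_residual]
    gives stability under [SL_2(k)]. Determinant 1 forces [\tr C = - pi ^+ N * \det C], so the
    residues are traceless. *)
Lemma level_full N : (0 < N)%N -> (exists2 X, level N X & ~ exists z, X = z%:M) ->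
  forall X, \tr X = 0 -> level N X.
Proof.
move=> N0; apply: (conj_stable_traceless k residue_pchar2 kbig).
- move=> _ _ [X [DX <-]] [Y [DY <-]].
  exists (X + Y + pi ^+ N *: (X * Y)); split; last by rewrite redm_addZ // map_mxD.
  by rewrite -mul_1DZ; apply: derivedM.
- move=> g _ g1 [X [DX <-]]; have [A [DA rA]] := derived_residual _ g1.
  exists (A * X * A^-1); split.
    have := derivedM _ _ (derivedM _ _ DA DX) (derivedV _ DA); congr (D _).
    rewrite mulrDr mulr1 mulrDl divrr ?derived_unit //.
    by rewrite -scalerAr -scalerAl.
  by rewrite !redmM redm_inv ?derived_unit // rA inv_det1.
- move=> _ [X [DX <-]]; have := derived_det _ DX; rewrite det_1DZ => e.
  rewrite trace_map_mx; have : \tr X = - (pi ^+ N * \det X).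
    apply/eqP; rewrite -addr_eq0 -(mulrI_eq0 _ (mulfI (expr_pi0 N))); apply/eqP.
    by apply: (@addrI _ 1); rewrite e addr0.
  by move=> ->; rewrite rmorphN rmorphM red_expi // mul0r oppr0.
Qed.

(** Surjectivity of the derived group onto [SL_2(R / pi^N)], phrased with representatives over
    [R]. *)
Definition approximates N := forall A : 'M[R]_2,
  (exists y, \det A = 1 + pi ^+ N * y) -> exists C, D (A + pi ^+ N *: C).

Lemma approximates1 : approximates 1.
Proof.
move=> A [y e]; have [|B [DB rB]] := derived_residual (redm A).
  by rewrite det_map_mx e rmorphD rmorph1 rmorphM red_expi // mul0r addr0.
by have [C eC] := redm_eq_pi _ _ rB; exists C; rewrite expr1 -eC.
Qed.

(** If [C] is the error of an approximation modulo [pi ^+ N], then [C * \adj A] is traceless modulo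
    [pi]. Multiplying by an element [1 + pi ^+ N *: E] with that residue changes the error to
    [C + C = 0] modulo [pi]. *)
Lemma approximatesS N : (0 < N)%N -> approximates N ->
  (exists2 X, level N X & ~ exists z, X = z%:M) -> approximates N.+1.
Proof.
move=> N0 aN /(level_full _ N0) full A [y e].
have [|C DC] := aN A; first by exists (pi * y); rewrite mulrA -exprSr.
have [|E [DE rE]] := full (redm (C * \adj A)).
  rewrite trace_map_mx; have := derived_det _ DC; rewrite det_addZ e exprSr => e'.
  have -> : \tr (C * \adj A) = - (pi * y + pi ^+ N * \det C).
    apply/eqP; rewrite -addr_eq0 -(mulrI_eq0 _ (mulfI (expr_pi0 N))); apply/eqP.
    by apply: (@addrI _ 1); rewrite addr0 -[RHS]e'; ring.
  by rewrite rmorphN rmorphD !rmorphM red_expi // red_pi !mul0r addr0 oppr0.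
have [|C' eC'] := redm0_pi (C + E * (A + pi ^+ N *: C)).
  rewrite map_mxD redmM rE redm_addZ // redmM -mulrA -redmM mul_adjl e.
  rewrite map_scalar_mx rmorphD rmorph1 rmorphM red_expi // mul0r addr0 mulr1.
  exact: (addrrM2 _ residue_pchar2).
exists C'; have := derivedM _ _ DE DC; congr (D _).
by rewrite exprSr -scalerA -eC' mulrDl mul1r -scalerAl -addrA -scalerDr.
Qed.

(* [1 = \det ((1 + pi^m) + pi^(2m) C) = 1 + pi^(2m) (1 + \tr C + ...)] forces the trace. *)
Lemma approximates_scalar m : (0 < m)%N -> approximates m.*2 ->
  exists C, D ((1 + pi ^+ m)%:M + pi ^+ m.*2 *: C) /\ red (\tr C) = 1.
Proof.
move=> m0 am; have [|C DC] := am (1 + pi ^+ m)%:M.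
  exists 1; rewrite !mx2E -addnn exprD; apply: (eq_mod2 _ R2 (pi ^+ m)); ring.
exists C; split=> //.
have := derived_det _ DC; have [a [b [c [d ->]]]] := mx2_ex C.
rewrite !mx2E -addnn exprD => e.
have : pi ^+ m * pi ^+ m * (1 + (1 + pi ^+ m) * (a + d) + pi ^+ m * pi ^+ m * (a * d
  - b * c)) = 0.
  by apply: (eq_mod2 _ R2 (- pi ^+ m)); apply: (@addrI _ 1); rewrite -[X in _ = X + _]e; ring.
move/eqP; rewrite !mulf_eq0 (negPf (expr_pi0 m)) /= => /eqP/(congr1 red).
rewrite !(rmorphD, rmorphM, rmorph1, rmorph0) /= red_expi // !mul0r !addr0 mul1r.
by move/(addr2_eq _ residue_pchar2) => <-.
Qed.

(** The scalar part of [h] is central, so only [pi ^+ m.*2 *: C] enters [g * h - h * g]; moreover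
    [h] reduces to 1 and drops out of the residue. *)
Lemma level_comm N m g C Y : (0 < m)%N -> D g -> D ((1 + pi ^+ m)%:M + pi ^+ m.*2 *: C) ->
  pi ^+ m.*2 *: (g * C - C * g) = pi ^+ N *: Y -> level N (redm Y * \adj (redm g)).
Proof.
move=> m0 Dg; set h := _ + _ => Dh eY.
have rh : redm h = 1.
  rewrite redm_addZ ?double_gt0 // map_scalar_mx rmorphD rmorph1 red_expi // addr0.
  by [].
exists (Y * g^-1 * h^-1); split; last first.
  by rewrite !redmM !redm_inv ?derived_unit // rh invr1 mulr1 inv_det1 // det_map_mx
    derived_det ?rmorph1.
have := derived_comm _ _ (derived_sub _ Dg) (derived_sub _ Dh); congr (D _).
rewrite commutator_sub ?derived_unit //; congr (_ + _).
rewrite !scalerAl -eY; do 2!congr (_ * _).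
rewrite /h mulrDr mulrDl -scalerAl -scalerAr -!mulmxE scalar_mxC opprD addrACA subrr add0r.
by rewrite scalerBr.
Qed.

Lemma approximates_nonscalar m N : (0 < m)%N -> N = m.*2 \/ N = m.*2.+1 ->
  approximates m.*2 -> approximates N -> exists2 X, level N X & ~ exists z, X = z%:M.
Proof.
move=> m0 NE am aN; have [C [DC]] := approximates_scalar _ m0 am.
rewrite -trace_map_mx; have [a [b [c [d rC]]]] := mx2_ex (redm C); rewrite rC mx2_tr => tC.
have nonscalar (X : 'M[k]_2) : X 0 1 != 0 -> ~ exists z, X = z%:M.
  by move=> X01 [z eX]; move: X01; rewrite eX mx2E mx2_01 eqxx.
case: NE => NE.
  (* The upper right entry will be [x * (1 + x * c)]. For [c = 0] the convention [c^-1 = 0] leaves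
     only the condition [x != 0]. *)
  have [x] := @exists_notin k kbig [:: 0; c^-1] isT.
  rewrite !inE negb_or => /andP[x0 xc].
  have [g [Dg rg]] := derived_residual _ (det_upper1 x).
  exists (redm (g * C - C * g) * \adj (redm g)).
    by apply: level_comm m0 Dg DC _; rewrite NE.
  apply: nonscalar; rewrite map_mxB !redmM rC rg !mx2E.
  have -> : d = 1 + a by rewrite -tC; apply: (@eq_mod2 _ residue_pchar2 (- a)); ring.
  apply/eqP => e; have : x * (1 + x * c) = 0.
    by apply: (@eq_mod2 _ residue_pchar2 (x ^+ 2 * c)); rewrite -[X in _ = X + _]e; ring.
  move/eqP; rewrite mulf_eq0 (negPf x0) /= => /eqP/(addr2_eq _ residue_pchar2) xc1.
  have c0 : c != 0 by apply: contra_eq_neq xc1 => ->; rewrite mulr0 oner_neq0.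
  by case/eqP: xc; rewrite -[RHS]mul1r xc1 mulfK.
(* For odd [N] the extra factor [pi] comes from a unipotent congruent to 1 modulo [pi]. The upper
   right entry of [E * C - C * E] is the difference of the diagonal entries of [C], which reduces to
   1. *)
have [|G DG] := aN (upper1 pi); first by exists 0; rewrite det_upper1 mulr0 addr0.
pose E : 'M[R]_2 := mx2 0 1 0 0.
pose Y := E * C - C * E + pi ^+ m.*2 *: (G * C - C * G).
have rg : redm (upper1 pi + pi ^+ N *: G) = 1.
  by rewrite redm_addZ ?NE // map_mx2 red_pi rmorph0 rmorph1 mx2E.
exists (redm Y * \adj (redm (upper1 pi + pi ^+ N *: G))).
  apply: level_comm m0 DG DC _.
  have -> : upper1 pi = 1 + pi *: E by rewrite !mx2E; apply: mx2_congr; ring.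
  rewrite NE !exprSr -!scalerA; congr (_ *: _).
  rewrite !mulrDl !mulrDr mul1r mulr1 -!scalerAl -!scalerAr !opprD -!scalerN.
  rewrite addrACA [X in X + _]addrACA subrr add0r /Y.
  by rewrite !scalerA ![pi ^+ _ * pi]mulrC -!scalerA -!scalerDr.
apply: nonscalar; rewrite rg -[\adj 1]/(\adj 1%:M) adj1 mulr1.
rewrite redm_addZ ?double_gt0 // map_mxB !redmM rC map_mx2 !(rmorph0, rmorph1) !mx2E.
by rewrite !(mul0r, mul1r, mulr0, mulr1, add0r,
  addr0) (oppr2 _ residue_pchar2) addrC tC oner_neq0.
Qed.

(** * Lifting by entrywise fourth powers *)

Definition Fm (G : 'M[R]_2) : 'M[R]_2 := map_mx (frob2 R R2) G.

Lemma FmM G G' : Fm (G * G') = Fm G * Fm G'.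
Proof. by rewrite /Fm -!mulmxE map_mxM. Qed.

Lemma tr_Fm G : \tr (Fm G) = \tr G ^+ 4.
Proof. by rewrite [LHS]trace_map_mx -frob2E. Qed.

Lemma det_Fm G : \det (Fm G) = \det G ^+ 4.
Proof. by rewrite [LHS]det_map_mx -frob2E. Qed.

Lemma scale_pi_inj m : injective (fun X : 'M[R]_2 => pi ^+ m *: X).
Proof.
move=> X Y /matrixP e; apply/matrixP => i j.
by apply: (mulfI (expr_pi0 m)); move: (e i j); rewrite !mxE.
Qed.

Lemma redm_Fm G : redm (Fm G) = map_mx (frob2 k residue_pchar2) (redm G).
Proof. by apply/matrixP => i j; rewrite !mxE !frob2E rmorphXn. Qed.

Lemma frob2_inj : injective (frob2 k residue_pchar2).
Proof.
move=> x y; rewrite !frob2E -[4%N]/(2 * 2)%N !exprM.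
by do 2!move/(sqr_inj2 k residue_pchar2).
Qed.

Lemma redm_Fm_inj G G' : redm (Fm G) = redm (Fm G') -> redm G = redm G'.
Proof. by rewrite !redm_Fm => /matrixP e; apply/matrixP => i j; move: (e i j);
  rewrite !mxE => /frob2_inj. Qed.

(** For [x = pi] this shows that [Fm G] modulo [pi ^+ 4] depends only on the residue of [G];
    together with [FmM] it makes [Fm] a multiplicative lifting. *)
Lemma Fm_addZ G E x : Fm (G + x *: E) = Fm G + x ^+ 4 *: Fm E.
Proof. by rewrite -(frob2E _ R2) /Fm map_mxD map_mxZ. Qed.

Lemma Fm_decomp1 h : \det (redm h) = 1 ->
  exists G X, h = (1 + pi *: X) * Fm G /\ redm (Fm G) = redm h.
Proof.
move=> h1.
have [g eg] : exists g, redm h = map_mx (frob2 k residue_pchar2) g.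
  have [a [b [c [d ->]]]] := mx2_ex (redm h).
  have [[a' ->] [b' ->]] := (root4_ex k residue_pchar2 a, root4_ex k residue_pchar2 b).
  have [[c' ->] [d' ->]] := (root4_ex k residue_pchar2 c, root4_ex k residue_pchar2 d).
  by exists (mx2 a' b' c' d'); rewrite map_mx2 !frob2E.
have [G rG] := red_lift_mx g.
have rF : redm (Fm G) = redm h by rewrite redm_Fm rG eg.
have Fu : Fm G \is a GRing.unit by apply: redm_unit; rewrite rF h1 oner_neq0.
have [C eC] := redm_eq_pi h (Fm G) (esym rF).
exists G, (C * (Fm G)^-1); split=> //.
by rewrite eC mulrDl mul1r -scalerAl mulrVK.
Qed.

(** The residue of the determinant is a square [s ^+ 2], so dividing [h] by a lift of [s] reduces to
    residual determinant 1. *)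
Lemma Fm_decomp h : \det (redm h) != 0 ->
  exists c G X, [/\ c \is a GRing.unit, h = c *: ((1 + pi *: X) * Fm G) & \det (redm (Fm G)) = 1].
Proof.
move=> h0; have [s es] := sqrt_ex k residue_pchar2 (\det (redm h)).
have s0 : s != 0 by move: h0; rewrite es expf_eq0.
have [c rc] := red_surj s.
have cu : c \is a GRing.unit by apply: red_unit; rewrite rc.
have h1 : \det (redm (c^-1 *: h)) = 1.
  by rewrite map_mxZ detZ es rmorphV // rc -exprMn mulVf // expr1n.
have [G [X [e rF]]] := Fm_decomp1 _ h1.
exists c, G, X; split=> //; first by rewrite -e scalerA divrr // scale1r.
by rewrite rF.
Qed.

(** * The case of a scalar first level *)

Hypothesis level1_scalar : forall B, D (1 + pi *: B) -> exists z, redm B = z%:M.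

(** Commutators of [h] with lifts from the derived group lie in its first level, so
    [g * B * g^-1 - B] has scalar residue for every [g] in [SL_2(k)]. Unipotent [g] then force [B]
    to be scalar modulo [pi]. *)
Lemma near_scalar h c B : H h -> c \is a GRing.unit -> h = c *: (1 + pi *: B) ->
  exists z, redm B = z%:M.
Proof.
move=> Hh cu eh.
have Zu : 1 + pi *: B \is a GRing.unit.
  by apply: redm_unit; rewrite (redm_addZ 1 B 1) // map_mx1 det1 oner_neq0.
have conj g : \det g = 1 -> exists z, (g * redm B - redm B * g) * \adj g = z%:M.
  move=> g1; have [A [DA rA]] := derived_residual g g1.
  have Au := derived_unit _ DA.
  have [|z ez] := level1_scalar ((A * B - B * A) * A^-1 * (1 + pi *: B)^-1).
    have := derived_comm _ _ (derived_sub _ DA) Hh; congr (D _).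
    rewrite eh invrZ // -!scalerAr -!scalerAl !scalerA ?mulVr ?mulrV // scale1r.
    rewrite commutator_sub // !scalerAl; congr (_ + _ * _ * _).
    by rewrite mulrDr mulrDl mulr1 mul1r opprD addrACA subrr add0r -scalerAr -scalerAl scalerBr.
  exists z; move: ez; rewrite !redmM !redm_inv // (redm_addZ 1 B 1) // map_mx1 invr1 mulr1.
  by rewrite map_mxB !redmM rA inv_det1.
move: conj; have [a [b [c' [d ->]]]] := mx2_ex (redm B) => conj.
(* This is the upper right entry of the condition at [upper1 x]; two distinct nonzero [x] give
   [c' = 0] and hence [a = d]. *)
have hU x : x != 0 -> d - a = x * c'.
  move=> x0; have [z] := conj _ (det_upper1 x); rewrite !mx2E => /mx2_inj[_ e _ _].
  apply: (mulfI x0); apply/eqP; rewrite -subr_eq0; apply/eqP.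
  by apply: etrans e; ring.
have c0 : c' = 0.
  have [x] := @exists_notin k kbig [:: 0; 1] isT.
  rewrite !inE negb_or => /andP[x0 x1].
  have /eqP := hU _ x0; rewrite (hU 1) ?oner_neq0 // -subr_eq0 -mulrBl mulf_eq0 subr_eq0 eq_sym.
  by rewrite (negPf x1) => /eqP.
have ad : a = d.
  by apply/esym/eqP; rewrite -subr_eq0 (hU 1) ?oner_neq0 // c0 mulr0.
have [z] := conj _ (det_lower1 1); rewrite c0 ad !mx2E => /mx2_inj[_ _ e _].
exists d; rewrite mx2E; apply: mx2_congr => //.
by apply/eqP; rewrite -oppr_eq0; apply/eqP; apply: etrans e; ring.
Qed.

(* [X], well defined modulo scalars, is the obstruction to [h] being a multiple of the
   lift [Fm G] of [g] modulo [pi ^+ 2]; fourth powers serve as multiplicative and additive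
   representatives of [k]. *)
Definition infinitesimal g X := exists h c G Y,
  [/\ H h, c \is a GRing.unit, h = c *: ((1 + pi *: Y) * Fm G), redm (Fm G) = g & redm Y = X].

(** The condition on [g] stands under the existential so that choice yields a function on all
    matrices, with 0 as default value. *)
Lemma infinitesimal_ex g : exists X, \det g = 1 -> infinitesimal g X.
Proof.
have [g1|g1] := eqVneq (\det g) 1; last by exists 0 => /eqP; rewrite (negPf g1).
have [h [Hh rh]] := Hres _ g1.
have [|G [Y [e rF]]] := Fm_decomp1 h; first by rewrite rh.
exists (redm Y) => _; exists h, 1, G, Y; split=> //; first exact: unitr1.
- by rewrite scale1r.
- by rewrite rF.
Qed.

(** [Fm] is multiplicative, and moving [Fm G] past [1 + pi *: Y'] conjugates [Y']. *)
Lemma infinitesimalM g g' X X' : \det g = 1 -> infinitesimal g X -> infinitesimal g' X' ->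
  infinitesimal (g * g') (X + g * X' * \adj g).
Proof.
move=> g1 [h [c [G [Y [Hh cu eh rG rY]]]]] [h' [c' [G' [Y' [Hh' cu' eh' rG' rY']]]]].
have Fu : Fm G \is a GRing.unit by apply: redm_unit; rewrite rG g1 oner_neq0.
exists (h * h'), (c * c'), (G * G'), (Y + Fm G * Y' * (Fm G)^-1 + pi *: (Y * (Fm G * Y' * (Fm
  G)^-1))).
split.
- exact: subgroupM.
- by rewrite unitrM cu.
- rewrite eh eh' -scalerAl -scalerAr scalerA; congr (_ *: _).
  rewrite FmM -mul_1DZ -!(mulrA (1 + pi *: Y)); congr (_ * _).
  rewrite [LHS]mulrA [RHS]mulrA; congr (_ * _).
  by rewrite mulrDl mul1r mulrDr mulr1 -scalerAl -scalerAr mulrVK.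
- by rewrite FmM redmM rG rG'.
by rewrite (redm_addZ _ _ 1) // map_mxD !redmM redm_inv // rG rY rY' inv_det1.
Qed.

(** The quotient of the two elements of [H] is a scalar times [W = 1 + pi *: B], so [near_scalar]
    makes [B] scalar modulo [pi]. Since [Fm G] and [Fm G'] agree modulo [pi ^+ 4], the residues of
    [Y] and [Y'] differ by that of [B]. *)
Lemma infinitesimal_uniq g X X' : \det g = 1 -> infinitesimal g X -> infinitesimal g X' ->
  pgl_coord k X = pgl_coord k X'.
Proof.
move=> g1 [h [c [G [Y [Hh cu eh rG rY]]]]] [h' [c' [G' [Y' [Hh' cu' eh' rG' rY']]]]].
have [E eE] := redm_eq_pi _ _ (redm_Fm_inj G G' (etrans rG (esym rG'))).
have Fu : Fm G' \is a GRing.unit by apply: redm_unit; rewrite rG' g1 oner_neq0.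
have Yu : 1 + pi *: Y' \is a GRing.unit.
  by apply: redm_unit; rewrite (redm_addZ 1 Y' 1) // map_mx1 det1 oner_neq0.
have gu := det1_unit _ _ g1.
pose W := (1 + pi *: Y) * Fm G * (Fm G')^-1 * (1 + pi *: Y')^-1.
have [|B eB] := redm_eq_pi W 1.
  rewrite !redmM !redm_inv // !(redm_addZ 1 _ 1) // rG rG' map_mx1 mul1r divrr //.
  by rewrite invr1 mulr1.
have eW : W * ((1 + pi *: Y') * Fm G') = (1 + pi *: Y) * Fm G.
  by rewrite mulrA /W mulrVK // mulrVK.
have [z ez] : exists z, redm B = z%:M.
  apply: (near_scalar (h * h'^-1) (c / c')).
  - by apply: subgroupM => //; apply: subgroupV.
  - by rewrite unitrM cu unitrV.
  - have ZFu : (1 + pi *: Y') * Fm G' \is a GRing.unit by rewrite unitrMl.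
    rewrite -eB eh eh' invrZ // -scalerAr -scalerAl scalerA invrM // /W mulrC.
    by rewrite !mulrA.
apply/(pgl_coordP k residue_pchar2); exists z.
have : redm B + X' = X.
  apply: (mulIr gu); rewrite -[in LHS]rG' -rG -rY -rY' -map_mxD -!redmM.
  have -> : (B + Y') * Fm G' = Y * Fm G + pi *: (pi ^+ 2 *: Fm E - B * Y' * Fm G').
    apply: (scale_pi_inj 1); rewrite /= expr1; move: eW.
    rewrite eB eE Fm_addZ mulrA mul_1DZ !mulrDl !mul1r mulrDr -!scalerAl -!scalerAr.
    rewrite !mulrDl mulrDr -!scalerAl -!scalerAr.
    move: (Fm G') (Fm E) (Y * Fm E) (Y * Fm G') (B * Y' * Fm G') (Y' * Fm G') (B * Fm G')
      => f w v u t y b.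
    move=> /matrixP e; apply/matrixP => i j; apply: (eq_by_sub _ _ _ _ _ (e i j)).
    by rewrite !mxE; ring.
  by rewrite (redm_addZ _ _ 1).
by rewrite ez addrC => ->.
Qed.

Lemma infinitesimal_coboundary :
  exists X0, forall g X, \det g = 1 -> infinitesimal g X -> exists z, X =
    X0 + g * X0 * \adj g + z%:M.
Proof.
have [d hd] := exists_choice_function _ _ _ infinitesimal_ex.
have [|X0 h0] := cocycle_coboundary k residue_pchar2 kbig d.
  move=> g h g1 h1; apply: (infinitesimal_uniq (g * h)).
  - by rewrite det_mulr g1 h1 mulr1.
  - by apply: hd; rewrite det_mulr g1 h1 mulr1.
  - by apply: infinitesimalM; [| exact: hd | exact: hd].
exists X0 => g X g1 iX; apply/(pgl_coordP k residue_pchar2).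
by rewrite -h0 //; apply: infinitesimal_uniq g1 iX (hd _ g1).
Qed.

(** Conjugation by [P = 1 + pi *: X], with [X] lifting the matrix [X0] of the coboundary, removes
    the first-order term up to a scalar, which the factor [c * (1 + pi * z')] absorbs. *)
Lemma level1_structure : exists2 P, P \is a GRing.unit &
  forall h, H h -> exists c G N, [/\ c \is a GRing.unit, \det G \is a GRing.unit
    & h * P = P * (c *: (Fm G + pi ^+ 2 *: N))].
Proof.
have [X0 hX0] := infinitesimal_coboundary.
have [X rX] := red_lift_mx X0.
pose P := 1 + pi *: X.
have Pu : P \is a GRing.unit.
  by apply: redm_unit; rewrite (redm_addZ 1 X 1) // map_mx1 det1 oner_neq0.
exists P => // h Hh.
have h0 : \det (redm h) != 0.
  have := subgroup_unit _ Hh; rewrite -[_ \is a _]/(h \in unitmx) unitmxE det_map_mx => hu.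
  by rewrite -unitfE rmorph_unit.
have [c [G [Y [cu eh rG]]]] := Fm_decomp _ h0.
have [z ez] := hX0 _ (redm Y) rG (ex_intro _ h (ex_intro _ c (ex_intro _ G (ex_intro _ Y (And5
  Hh cu eh erefl erefl))))).
have [z' rz] := red_surj z.
have Gu : \det G \is a GRing.unit.
  apply: red_unit; move: rG; rewrite det_map_mx det_Fm rmorphXn => e.
  by apply: contra_eq_neq e => ->; rewrite expr0n eq_sym oner_neq0.
have zu : 1 + pi * z' \is a GRing.unit.
  by apply: red_unit; rewrite rmorphD rmorphM red_pi mul0r addr0 rmorph1 oner_neq0.
(* This is the difference of [(1 + pi *: Y) * Fm G * P] and [(1 + pi * z') *: (P * Fm G)], divided
   by [pi]. Modulo [pi] the coboundary formula for [Y] leaves two copies of [g * X0], which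
   cancel. *)
have [|E eE] := redm0_pi (Y * Fm G + Fm G * X - z' *: Fm G - X * Fm G + pi *: (Y * Fm G * X
  - z' *: (X * Fm G))).
  rewrite (redm_addZ _ _ 1) // !map_mxB map_mxD !redmM map_mxZ rX rz ez.
  move: (redm (Fm G)) rG => g g1.
  rewrite !mulrDl -(mulrA _ (\adj g) g) mul_adjl g1 mulr1 -[z%:M * g]/(z%:M *m g) mul_scalar_mx.
  move: (g * X0) (X0 * g) => a b.
  by apply/matrixP => i j; rewrite !mxE; apply: (@eq_mod2 _ residue_pchar2 (a i j)); ring.
exists (c * (1 + pi * z')), G, ((1 + pi * z')^-1 *: (P^-1 * E)); split=> //.
  by rewrite unitrM cu.
rewrite eh -scalerAl -scalerAr -!scalerA; congr (_ *: _).
rewrite [in RHS]mulrDr -!scalerAr mulVKr // [RHS]scalerDr.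
have -> : (1 + pi * z') *: (pi *: (pi *: ((1 + pi * z')^-1 *: E))) = pi *: (pi *: E).
  by rewrite !scalerA; congr (_ *: _); rewrite mulrC !mulrA mulVr // mul1r.
rewrite -eE.
rewrite /P !mulrDl !mulrDr !mul1r !mulr1 -!scalerAl -!scalerAr.
move: (Fm G * X) (X * Fm G) (Y * Fm G * X) (Y * Fm G) (Fm G) => a b t y f.
by apply/matrixP => i j; rewrite !mxE; ring.
Qed.

(** * A character of [H] and its triviality on [H'] *)

Section Character.
Variable P : 'M[R]_2.
Hypothesis Pu : P \is a GRing.unit.
Hypothesis HP : forall h, H h -> exists c G N, [/\ c \is a GRing.unit,
  \det G \is a GRing.unit & h * P = P * (c *: (Fm G + pi ^+ 2 *: N))].

(* The graph of the character [det h / c ^+ 2] modulo fourth powers and [pi ^+ 3]. *)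
Definition character h x := exists c G N r, [/\ c \is a GRing.unit,
  \det G \is a GRing.unit, h * P = P * (c *: (Fm G + pi ^+ 2 *: N)),
  \det h = c ^+ 2 * \det G ^+ 4 * (1 + pi ^+ 2 * r) & red r = x].

Lemma character_ex h : H h -> exists x, character h x.
Proof.
move=> /HP[c [G [N [cu Gu e]]]].
pose s := \tr (N * \adj (Fm G)) + pi ^+ 2 * \det N.
exists (red (s / \det G ^+ 4)), c, G, N, (s / \det G ^+ 4); split=> //.
have : \det (h * P) = \det P * (c ^+ 2 * (\det G ^+ 4 + pi ^+ 2 * s)).
  by rewrite e det_mulr detZ det_addZ det_Fm.
rewrite det_mulr mulrC; move: Pu;
  rewrite -[P \is a _]/(P \in unitmx) unitmxE => Pu' /(mulrI Pu') ->.
rewrite -[RHS]mulrA; congr (_ * _); rewrite [RHS]mulrDr mulr1; congr (_ + _).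
by rewrite mulrCA [_ ^+ 4 * _]mulrC divrK // unitrX.
Qed.

Lemma characterM h h' x x' : character h x -> character h' x' -> character (h * h') (x + x').
Proof.
move=> [c [G [N [r [cu Gu e dh <-]]]]] [c' [G' [N' [r' [cu' Gu' e' dh' <-]]]]].
exists (c * c'), (G * G'), (Fm G * N' + N * Fm G' + pi ^+ 2 *: (N * N')),
  (r + r' + pi ^+ 2 * (r * r')); split.
- by rewrite unitrM cu.
- by rewrite det_mulr unitrM Gu.
- rewrite -mulrA e' mulrA e -mulrA; congr (_ * _).
  rewrite -scalerAl -scalerAr scalerA; congr (_ *: _).
  rewrite FmM !mulrDl !mulrDr -!scalerAl -!scalerAr.
  move: (Fm G * Fm G') (Fm G * N') (N * Fm G') (N * N') => X1 X2 X3 X4.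
  by apply/matrixP => i j; rewrite !mxE; ring.
- by rewrite !det_mulr dh dh'; ring.
- by rewrite red_addZ // rmorphD.
Qed.

(** By multiplicativity, uniqueness of the value reduces to this case. Here [G] is upper right zero
    with equal diagonal entries modulo [pi], so [\det G ^+ 4] is [a ^+ 8] modulo [pi ^+ 4]. Squaring
    the first diagonal entry also gives [c ^+ 2 * a ^+ 8 = 1] modulo [pi ^+ 4], which leaves no room
    for [pi ^+ 2 * r] unless [red r = 0]. *)
Lemma character1 x : character 1 x -> x = 0.
Proof.
move=> [c [G [N [r [cu Gu e dh <-]]]]].
have {e} : (1 : 'M[R]_2) = c *: (Fm G + pi ^+ 2 *: N).
  by apply: (mulrI Pu); rewrite -e mulr1 mul1r.
have [a [b [b' [d eG]]]] := mx2_ex G; have [n [n1 [n2 [n3 ->]]]] := mx2_ex N.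
move: dh Gu; rewrite det1 /Fm eG map_mx2 !frob2E !mx2E => dh Gu /mx2_inj[e1 e2 e3 e4].
have red_c0 y : 0 = c * y -> red y = 0.
  by move/eqP; rewrite eq_sym mulf_eq0 => /orP[/eqP c0|/eqP -> ]; [move: cu;
    rewrite c0 unitr0|rewrite rmorph0].
have [b0 eb] : exists b0, b = pi * b0.
  apply: red0_pi; apply/eqP; have := red_c0 _ e2.
  by rewrite red_addZ // rmorphXn => /eqP; rewrite expf_eq0.
have [d0 ed] : exists d0, d = a + pi * d0.
  have [|d0 ed] := red0_pi (d - a).
    rewrite rmorphB; apply/eqP; rewrite subr_eq0; apply/eqP.
    apply: frob2_inj; rewrite !frob2E -!rmorphXn; apply/eqP; rewrite -subr_eq0 -rmorphB; apply/eqP.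
    have -> : d ^+ 4 - a ^+ 4 =
        (d ^+ 4 + pi ^+ 2 * n3 - (a ^+ 4 + pi ^+ 2 * n)) + pi ^+ 2 * (n - n3) by ring.
    rewrite red_addZ //; apply: red_c0.
    by rewrite mulrBr -e1 -e4 subrr.
  by exists d0; rewrite -ed addrC subrK.
pose s := a * d0 - b0 * b'.
have edet : (a * d - b * b') ^+ 4 = a ^+ 8 + pi ^+ 4 * s ^+ 4.
  have -> : a * d - b * b' = a ^+ 2 + pi * s by rewrite eb ed /s; ring.
  by rewrite (expr4D _ R2); ring.
rewrite edet in dh.
pose u := a ^+ 4 + pi ^+ 2 * n.
have e : r * (c ^+ 2 * (a ^+ 8 + pi ^+ 4 * s ^+ 4)) = pi ^+ 2 * (c ^+ 2 * (n ^+ 2 - s ^+ 4)).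
  have cu1 : c ^+ 2 * u ^+ 2 = 1 by rewrite -exprMn -e1 expr1n.
  apply: (mulfI (expr_pi0 2)); apply: (@addrI _ (c ^+ 2 * (a ^+ 8 + pi ^+ 4 * s ^+ 4))).
  transitivity (1 : R); first by rewrite [RHS]dh; ring.
  rewrite -cu1; apply: (eq_mod2 _ R2 (c ^+ 2 * a ^+ 4 * pi ^+ 2 * n)); rewrite /u; ring.
have cG : c ^+ 2 * (a ^+ 8 + pi ^+ 4 * s ^+ 4) \is a GRing.unit.
  by rewrite -edet unitrM !unitrX.
move/(congr1 red)/eqP: e.
rewrite [X in _ == X]rmorphM red_expi // mul0r rmorphM mulf_eq0 => /orP[/eqP //|/eqP e0].
by have := rmorph_unit red cG; rewrite e0 unitr0.
Qed.

(** The character is locally constant: the perturbation is absorbed in [N] and changes [r] by a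
    multiple of [pi ^+ 2]. This makes preimages of subsets of [k] closed in [H]. *)
Lemma character_near h h' E x : h' = h + pi ^+ 4 *: E -> character h x -> character h' x.
Proof.
move=> -> [c [G [N [r [cu Gu e dh <-]]]]].
have du : c ^+ 2 * \det G ^+ 4 \is a GRing.unit by rewrite unitrM !unitrX.
pose s := \tr (E * \adj h) + pi ^+ 4 * \det E.
exists c, G, (N + pi ^+ 2 *: (c^-1 *: (P^-1 * E * P))),
  (r + pi ^+ 2 * (s / (c ^+ 2 * \det G ^+ 4))).
split=> //; last by rewrite red_addZ.
- rewrite mulrDl e -scalerAl -[E in LHS](mulVKr Pu) -!mulrA scalerAr -mulrDr; congr (_ * _).
  rewrite !scalerDr -addrA; congr (_ + (_ + _)).
  rewrite !scalerA !mulrA; congr (_ *: _).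
  by rewrite -[LHS]mulr1 -(divrr cu); ring.
rewrite det_addZ -/s dh; move: (c ^+ 2 * _) s du => d s du.
by transitivity (d * (1 + pi ^+ 2 * r) + pi ^+ 4 * (s / d * d)); [rewrite divrK | ring].
Qed.

Lemma character_uniq h x y : H h -> character h x -> character h y -> x = y.
Proof.
move=> Hh hx hy; have [z hz] := character_ex _ (subgroupV _ Hh).
have E t : character h t -> t + z = 0.
  move=> ht; apply: character1; rewrite -(divrr (subgroup_unit _ Hh)).
  exact: characterM.
by apply: (@addIr _ z); rewrite !E.
Qed.

Lemma characterV h x : H h -> character h x -> character h^-1 x.
Proof.
move=> Hh hx; have [z hz] := character_ex _ (subgroupV _ Hh).
suff -> : x = z by [].
apply: (addr2_eq _ residue_pchar2); apply: character1.
by rewrite -(divrr (subgroup_unit _ Hh)); apply: characterM.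
Qed.

Lemma mx_cvg_near A L m : mx_cvg pi A L -> exists n E, L = A n + pi ^+ m *: E.
Proof.
move=> cAL.
have [[n0 h0] [n1 h1]] := (cAL 0 0 m, cAL 0 1 m).
have [[n2 h2] [n3 h3]] := (cAL 1 0 m, cAL 1 1 m).
pose n := (n0 + n1 + n2 + n3)%N.
have [|y0 e0] := h0 n; first by rewrite /n -!addnA leq_addr.
have [|y1 e1] := h1 n; first by rewrite /n -!addnA addnCA leq_addr.
have [|y2 e2] := h2 n; first by rewrite /n -addnA addnCA leq_addr.
have [|y3 e3] := h3 n; first by rewrite /n leq_addl.
exists n, (- mx2 y0 y1 y2 y3).
rewrite [L]mx2_eta [A n]mx2_eta !mx2E !mulrN -e0 -e1 -e2 -e3.
by apply: mx2_congr; rewrite opprB addrC subrK.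
Qed.

(** If [h] had a nonzero value [x], a subgroup [M] of [k] maximal among those avoiding [x] would
    have index 2, and its preimage would be a closed subgroup of index 2 in [H] avoiding [h]. *)
Lemma Hprime_character h : closed_mx pi H -> Hprime pi H h -> character h 0.
Proof.
move=> Hcl [Hh Hp]; have [x hx] := character_ex _ Hh.
have [x0|x0] := eqVneq x 0; first by rewrite -x0.
pose Q (M : {set k}) := [&& 0 \in M, [forall a in M, forall b in M, a + b \in M] & x \notin M].
have Q0 : Q [set 0].
  rewrite /Q !inE eqxx x0 andbT /=; apply/forall_inP => a /set1P ->.
  by apply/forall_inP => b /set1P ->; rewrite addr0 inE.
have [M /maxsetP[/and3P[M0 /forall_inP MD xM] Mmax] _] := maxset_exists Q0.
have MA a b : a \in M -> b \in M -> a + b \in M by move=> aM bM; apply: (forall_inP (MD a aM)).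
have Mcoset a : a \notin M -> x + a \in M.
  move=> aM; apply: contraNT aM => xaM.
  (* [M'] is the subgroup generated by [M] and [a]. It still avoids [x] when [x + a] is outside [M],
     so maximality gives [M' = M]. *)
  pose M' := [set b | (b \in M) || (b + a \in M)].
  have -> : M = M'.
    apply/esym/Mmax; last by apply/subsetP => b; rewrite inE => ->.
    rewrite /Q !inE M0 (negPf xM) (negPf xaM) andbT /=.
    apply/forall_inP => b; rewrite inE => hb; apply/forall_inP => d; rewrite !inE => hd.
    case/orP: hb => hb; case/orP: hd => hd; apply/orP.
    - by left; apply: MA.
    - by right; rewrite -addrA; apply: MA.
    - by right; rewrite addrAC; apply: MA.
    - left; suff -> : b + d = b + a + (d + a) by apply: MA.
      by apply: (@eq_mod2 _ residue_pchar2 (- a)); ring.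
  by rewrite inE (addrr2 _ residue_pchar2) M0 orbT.
pose K A := H A /\ exists2 m, m \in M & character A m.
have Kcl : closed_mx pi K.
  move=> A L KA cAL; split; first by apply: Hcl cAL => n; case: (KA n).
  have [n [E e]] := mx_cvg_near A L 4 cAL.
  by have [_ [m mM hm]] := KA n; exists m => //; apply: character_near e hm.
have nKh : ~ K h.
  by case=> _ [m mM /(character_uniq _ _ _ Hh hx) xm]; rewrite xm mM in xM.
case: nKh; apply: (Hp K Kcl); split; last split; last exists h; last split=> //.
- split=> [A [HA _]|]; first exact: subgroup_unit.
  split.
    have H1 : H 1 by case: Hgrp => _ [].
    split=> //; have [y hy] := character_ex _ H1; exists y => //.
    by rewrite (character1 _ hy).
  split=> [A B [HA [a aM ha]] [HB [b bM hb]]|A [HA [a aM ha]]].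
    split; first exact: subgroupM.
    by exists (a + b); [exact: MA | exact: characterM].
  split; first exact: subgroupV.
  by exists a => //; apply: characterV.
- by move=> A [].
split.
  by case=> _ [m mM /(character_uniq _ _ _ Hh hx) xm]; rewrite xm mM in xM.
move=> A HA; have [a ha] := character_ex _ HA.
have [aM|aM] := boolP (a \in M); first by left; split=> //; exists a.
right; split; first by apply: subgroupM => //; apply: subgroupV.
exists (x + a); first exact: Mcoset.
by apply: characterM => //; apply: characterV.
Qed.

(** In [\tr h ^+ 2 / \det h] the factor [c ^+ 2] cancels. The squared trace is a fourth power modulo
    [pi ^+ 4], and triviality of the character makes the determinant a fourth power modulo
    [pi ^+ 3]. *)
Lemma TrAd_Hprime h : closed_mx pi H -> Hprime pi H h ->
  exists y z, TrAd h = y ^+ 4 + pi ^+ 3 * z.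
Proof.
move=> Hcl Hph; have Hh : H h by case: Hph.
have [c [G [N [r [cu Gu e dh /red0_pi[r' er]]]]]] := Hprime_character _ Hcl Hph.
have th : \tr h = c * (\tr G ^+ 4 + pi ^+ 2 * \tr N).
  have -> : h = P * (c *: (Fm G + pi ^+ 2 *: N)) * P^-1 by rewrite -e mulrK.
  rewrite -mulmxE mxtrace_mulC mulmxE mulKr // mxtraceZ mxtraceD mxtraceZ tr_Fm.
  by [].
have := TrAd_det _ h (subgroup_unit _ Hh).
rewrite dh th er; set t := TrAd h; set tau := \tr G; set n := \tr N; set d := \det G => E.
exists (tau ^+ 2 / d), (pi * n ^+ 2 / d ^+ 4 - t * r').
have cdu : c ^+ 2 * d ^+ 4 \is a GRing.unit by rewrite unitrM !unitrX.
apply: (mulrI cdu).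
transitivity (t * (c ^+ 2 * d ^+ 4 * (1 + pi ^+ 2 * (pi * r')))
  - pi ^+ 3 * (c ^+ 2 * d ^+ 4 * t * r')).
  by ring.
rewrite {}E.
transitivity (c ^+ 2 * (tau ^+ 8 * (d / d) ^+ 4 + pi ^+ 4 * n ^+ 2 * (d / d) ^+ 4)
  - pi ^+ 3 * (c ^+ 2 * d ^+ 4 * t * r')).
  rewrite divrr // !expr1n !mulr1; apply: (eq_mod2 _ R2 (c ^+ 2 * pi ^+ 2 * tau ^+ 4 * n)). ring.
rewrite !exprMn !exprVn; ring.
Qed.

End Character.

Lemma level1_nonscalar_of_TrAd : closed_mx pi H ->
  top_generates pi (fun t => exists h, Hprime pi H h /\ t = TrAd h)
                   (fun t => exists y : R, t = y ^+ 2) -> False.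
Proof.
move=> Hcl /(_ (pi ^+ 2))[_ gen].
have [P Pu HP] := level1_structure.
pose S (x : R) := exists y z, x = y ^+ 4 + pi ^+ 3 * z.
have : S (pi ^+ 2).
  apply: gen; first by exists pi.
  (* [S] is stable under adding multiples of [pi ^+ 3], so one term that close to the limit
     suffices. *)
  - move=> u l uS ul; have [n /(_ n (leqnn n))[w ew]] := ul 3%N.
    have [y [z e]] := uS n; exists y, (z - w).
    by rewrite mulrBr -ew e; ring.
  - split; first by exists 1, 0; rewrite expr1n mulr0 addr0.
    split=> _ _ [y [z ->]] [y' [z' ->]].
      by exists (y - y'), (z - z'); rewrite (expr4D _ R2); apply: (eq_mod2 _ R2 (- y' ^+ 4)); ring.
    by exists (y * y'), (y ^+ 4 * z' + z * y' ^+ 4 + pi ^+ 3 * (z * z')); ring.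
  - by move=> _ [h [Hh ->]]; apply: (TrAd_Hprime P).
move=> [y [z e]].
(* Reduction makes [y] divisible by [pi]; then [y ^+ 4 + pi ^+ 3 * z] is divisible by [pi ^+ 3],
   while [pi ^+ 2] is not. *)
have [y' ey] : exists y', y = pi * y'.
  apply: red0_pi; apply/eqP; have := congr1 red e.
  by rewrite red_addZ // red_expi // rmorphXn => /esym/eqP; rewrite expf_eq0.
have e1 : 1 = pi * (pi * y' ^+ 4 + z).
  by apply: (mulfI (expr_pi0 2)); rewrite mulr1 {1}e ey; ring.
by have /eqP := congr1 red e1; rewrite rmorphM red_pi mul0r rmorph1 oner_eq0.
Qed.

End DerivedGroup.

End ResidueField.

(** * Induction on the level and passage to the limit *)

Lemma dvr_separated (R : idomainType) (pi x : R) :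
  is_dvr pi -> (forall m, pi_dvd pi m x) -> x = 0.
Proof.
move=> [pi0 [piu dvr]] hx; apply/eqP; apply/negPn/negP => /dvr[n [u [uu ex]]].
have [y ey] := hx n.+1.
have e : u = pi * y by apply: (mulIf (expf_neq0 n pi0)); rewrite -ex ey exprS; ring.
by move: uu piu; rewrite e unitrM => /andP[->].
Qed.

Theorem mainTheorem17 (R : idomainType) (pi : R) (k : finFieldType)
  (red : {rmorphism R -> k}) (H : 'M[R]_2 -> Prop) :
  is_dvr pi -> complete pi -> (2 \in [pchar R])%N ->
  (forall y : k, exists x : R, red x = y) ->
  (forall x : R, red x = 0 <-> pi_dvd pi 1 x) ->
  (9 < #|k|)%N ->
  subgroup_GL2 H -> closed_mx pi H ->
  (forall B : 'M[k]_2, \det B = 1 -> exists A, H A /\ map_mx red A = B) ->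
  top_generates pi (fun t => exists h, Hprime pi H h /\ t = TrAd h)
                   (fun t => exists y : R, t = y ^+ 2) ->
  forall A : 'M[R]_2, Hder pi H A <-> \det A = 1.
Proof.
move=> dvr _ R2 red_surj red_ker kbig Hgrp Hcl Hres gen.
have level1 : exists2 X, level (pi := pi) (red := red) H 1 X & ~ exists z, X = z%:M.
  apply: NNPP => no; apply: (level1_nonscalar_of_TrAd dvr R2 red_surj red_ker _ Hgrp kbig Hres
    _ Hcl gen).
  move=> B DB; apply: NNPP => nB; apply: no; exists (map_mx red B); last exact: nB.
  by exists B; rewrite expr1.
have approx N : (0 < N)%N -> approximates (pi := pi) H N.
  elim/ltn_ind: N => -[|[|N]] IH // _; first exact: (approximates1 R2 red_ker _ Hgrp kbig Hres).
  apply: (approximatesS dvr R2 red_ker _ Hgrp kbig Hres) => //; first exact: IH.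
  case: N IH => [|N] IH; first exact: level1.
  (* At level [N.+2] the scalar lift uses half the level, rounded down. Its double is at most
     [N.+2], so strong induction supplies both approximations. *)
  have m0 : (0 < (N.+2)./2)%N by [].
  apply: (approximates_nonscalar dvr R2 red_ker _ Hgrp kbig Hres (N.+2)./2) => //.
  - by case: (odd N.+2) (odd_double_half N.+2) => e; [right|left]; rewrite -[LHS]e.
  - by apply: IH; rewrite ?double_gt0 //; rewrite ltnS -[leqRHS]odd_double_half leq_addl.
  - exact: IH.
move=> A; split=> [[B [DB cBA]]|A1].
  (* The determinant of the limit is 1 modulo every power of [pi]. *)
  apply/eqP; rewrite -subr_eq0; apply/eqP; apply: (dvr_separated _ _ _ dvr) => m.
  have [n [E ->]] := mx_cvg_near _ _ m cBA.
  by rewrite det_addZ (derived_det _ Hgrp _ (DB n)) addrC addKr; eexists.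
(* The exponent [n.+1] keeps the level positive for [n = 0]; the resulting elements of the derived
   group converge to [A]. *)
have [C hC] : exists C : nat -> 'M[R]_2, forall n, derived H (A + pi ^+ n.+1 *: C n).
  apply: (exists_choice_function _ _ (fun n X => derived H (A + pi ^+ n.+1 *: X))) => n.
  by apply: approx => //; exists 0; rewrite A1 mulr0 addr0.
exists (fun n => A + pi ^+ n.+1 *: C n); split=> // i j m; exists m => n mn.
exists (pi ^+ (n.+1 - m) * C n i j).
by rewrite /= !mxE addrAC subrr add0r mulrA -exprD subnKC // leqW.
Qed.
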